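(* Let $(R,M)$ be a finitely stable local ring whose maximal ideal $M$ is regular and stable, and let $R_\infty$ be as defined in the context. Then $R$ is a quadratic ring and $R_\infty$ has at most two maximal ideals.
   Context: All rings are commutative with identity; a local ring is a ring with a unique maximal ideal (not necessarily Noetherian). $Q(R)$ is the total ring of quotients, $\operatorname{Jac} R$ the Jacobson radical. An ideal is regular if it contains a nonzerodivisor. A fractional ideal of $R$ is an $R$-submodule $I$ of $Q(R)$ with $bI\subseteq R$ for some nonzerodivisor $b\in R$; it is regular if it contains a nonzerodivisor. For a regular fractional ideal $I$, $E(I)=\{q\in Q(R):qI\subseteq I\}$ (the endomorphism ring of $I$), and $I$ is stable if $I$ is projective as an $E(I)$-module. $R$ is finitely stable if every finitely generated regular ideal of $R$ is stable. An extension $R\subseteq S$ is quadratic if $xy\in xR+yR+R$ for all $x,y\in S$. If $\operatorname{Jac} R$ is regular, define $R_0=R$, $R_i=E(\operatorname{Jac} R_{i-1})$ for $i\ge1$, and $R_\infty=\bigcup_{i\ge1}R_i$ (all inside $Q(R)$). $R$ is a quadratic ring if $R$ is local, its maximal ideal is regular and stable, and $R\subseteq R_\infty$ is a quadratic extension. *)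

(* Defs.v *)
(* Rings are modelled inside an ambient commutative ring Q
   which is (a copy of) the total ring of quotients of R; R and all the
   other rings/ideals are Prop-valued subsets of Q. *)
From HB Require Import structures.
From mathcomp Require Import all_boot all_order all_algebra.
Set Implicit Arguments. Unset Strict Implicit. Unset Printing Implicit Defensive.
Import GRing.Theory.
Local Open Scope ring_scope.

Section Defs.
Variable Q : comUnitRingType.

Definition qset := Q -> Prop.

Definition set_eq (A B : qset) : Prop := forall x, A x <-> B x.
Definition subset (A B : qset) : Prop := forall x, A x -> B x.

Definition subring (S : qset) : Prop :=
  S 1 /\ (forall x y, S x -> S y -> S (x - y)) /\ (forall x y, S x -> S y -> S (x * y)).

Definition nzd (S : qset) (x : Q) : Prop :=
  S x /\ forall y, S y -> x * y = 0 -> y = 0.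

Definition is_total_quotient_ring (R : qset) : Prop :=
  subring R /\
  (forall b, nzd R b -> b \is a GRing.unit) /\
  (forall q, exists a b, R a /\ nzd R b /\ q = a / b).

Definition ideal (S I : qset) : Prop :=
  subset I S /\ I 0 /\ (forall x y, I x -> I y -> I (x + y)) /\
  (forall s x, S s -> I x -> I (s * x)).

Definition maximal_ideal (S P : qset) : Prop :=
  ideal S P /\ ~ P 1 /\
  (forall N, ideal S N -> subset P N -> set_eq N P \/ N 1).

Definition local (S : qset) : Prop :=
  exists M, maximal_ideal S M /\ forall N, maximal_ideal S N -> set_eq N M.

Definition Jac (S : qset) : qset :=
  fun x => S x /\ forall P, maximal_ideal S P -> P x.

Definition regular_ideal (R I : qset) : Prop := exists x, I x /\ nzd R x.

Definition fractional_ideal (R I : qset) : Prop :=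
  I 0 /\ (forall x y, I x -> I y -> I (x + y)) /\
  (forall r x, R r -> I x -> I (r * x)) /\
  exists b, nzd R b /\ forall x, I x -> R (b * x).

Definition regular_frac (I : qset) : Prop := exists x, I x /\ nzd (fun _ => True) x.

Definition End (I : qset) : qset := fun q => forall a, I a -> I (q * a).

(* I is a projective E-module, i.e. a direct summand (retract) of a free
   E-module E^(J): section a |-> (f j a)_j (finitely supported), retraction
   e_j |-> x j. *)
Definition projective_over (E I : qset) : Prop :=
  exists (J : eqType) (x : J -> Q) (f : J -> Q -> Q),
    (forall j, I (x j)) /\
    (forall j a, I a -> E (f j a)) /\
    (forall j a b, I a -> I b -> f j (a + b) = f j a + f j b) /\
    (forall j e a, E e -> I a -> f j (e * a) = e * f j a) /\
    (forall a, I a -> exists s : seq J,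
        uniq s /\ (forall j, j \notin s -> f j a = 0) /\
        a = \sum_(j <- s) f j a * x j).

Definition stable (R I : qset) : Prop :=
  fractional_ideal R I /\ regular_frac I /\ projective_over (End I) I.

Definition fin_gen_ideal (R I : qset) : Prop :=
  exists s : seq Q, (forall i, (i < size s)%N -> R s`_i) /\
    forall x, I x <-> exists c : nat -> Q,
      (forall i, R (c i)) /\ x = \sum_(i < size s) c i * s`_i.

Definition finitely_stable (R : qset) : Prop :=
  forall I, ideal R I -> fin_gen_ideal R I -> regular_ideal R I -> stable R I.

Definition quadratic_ext (R S : qset) : Prop :=
  forall x y, S x -> S y ->
    exists a b c, R a /\ R b /\ R c /\ x * y = x * a + y * b + c.

Fixpoint Rseq (R : qset) (n : nat) : qset :=
  match n with
  | 0 => R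
  | n'.+1 => End (Jac (Rseq R n'))
  end.

Definition Rinf (R : qset) : qset := fun x => exists i, (1 <= i)%N /\ Rseq R i x.

Definition quadratic_ring (R : qset) : Prop :=
  local R /\
  (exists M, maximal_ideal R M /\ regular_ideal R M /\ stable R M) /\
  quadratic_ext R (Rinf R).

Definition at_most_two_maximal_ideals (S : qset) : Prop :=
  forall P1 P2 P3, maximal_ideal S P1 -> maximal_ideal S P2 -> maximal_ideal S P3 ->
    set_eq P1 P2 \/ set_eq P1 P3 \/ set_eq P2 P3.

End Defs.

(* Main.v *)
(* Let S be a finitely stable local ring with regular maximal ideal M and
   T = End M.  A finitely generated regular S-module J containing 1 is invertible
   over End J; if End J is contained in S, then J is principal because S is local.
   Applied to J = S + Sy this shows that S + Sy is a ring for every y in T.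
   If T has two distinct maximal ideals P1 and P2, a similar argument with
   two-generated modules shows that P1 and P2 meet in M, so that Jac T = M and the
   sequence R_i is stationary from T on.  Otherwise T is again local and finitely
   stable and the construction goes on.  Thus every R_n has at most two maximal
   ideals and is integral over R; three pairwise comaximal ideals of R_infinity
   would already be visible in some R_n.

   For x, y in R_n put J = R + Rx + Ry, E = End J and A = (E : J), so that AJ = E.
   Avoiding the at most two maximal ideals of R_n, the ideal A contains a unit of
   R_n, which is a unit of E by integrality.  Hence J = E is a ring and xy is
   in J. *)
From HB Require Import structures.
From Pilot Require Import Defs.
From mathcomp Require Import all_boot all_order all_algebra.
From mathcomp Require Import boolp ring.
From mathcomp Require classical_sets.
Import Pilot.Defs.
Set Implicit Arguments. Unset Strict Implicit. Unset Printing Implicit Defensive.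
Import GRing.Theory.
Local Open Scope ring_scope.

(** * Subrings, submodules and endomorphism rings inside the ambient ring *)

Section Closure.
Variable Q : comUnitRingType.
Implicit Types (S I J E : qset Q) (x y : Q).

Lemma qset_ext (A B : qset Q) : set_eq A B -> A = B.
Proof. by move=> eAB; apply/funext => x; apply/propext. Qed.

(** Containment in [S] is dropped from [ideal], so that fractional modules and overrings are covered
    too. *)
Definition submodule S I : Prop :=
  I 0 /\ (forall x y, I x -> I y -> I (x + y)) /\
  (forall s x, S s -> I x -> I (s * x)).

Lemma subring1 S : subring S -> S 1.
Proof. by case. Qed.

Lemma subringB S : subring S -> forall x y, S x -> S y -> S (x - y).
Proof. by case=> _ []. Qed.

Lemma subringM S : subring S -> forall x y, S x -> S y -> S (x * y).
Proof. by case=> _ []. Qed.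

Lemma subring0 S : subring S -> S 0.
Proof. by move=> hS; rewrite -(subrr 1); apply: subringB => //; apply: subring1. Qed.

Lemma subringN S : subring S -> forall x, S x -> S (- x).
Proof. by move=> hS x Sx; rewrite -sub0r; apply: subringB => //; apply: subring0. Qed.

Lemma subringD S : subring S -> forall x y, S x -> S y -> S (x + y).
Proof. by move=> hS x y Sx Sy; rewrite -[y]opprK; apply: subringB => //; apply: subringN. Qed.

Lemma subringX S : subring S -> forall x n, S x -> S (x ^+ n).
Proof.
move=> hS x n Sx; elim: n => [|n IH]; first by rewrite expr0; apply: subring1.
by rewrite exprS; apply: subringM.
Qed.

Lemma ideal_submodule S I : ideal S I -> submodule S I.
Proof. by case. Qed.

Lemma ideal_sub S I : ideal S I -> subset I S.
Proof. by case. Qed.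

Lemma submodule0 S I : submodule S I -> I 0.
Proof. by case. Qed.

Lemma submoduleD S I : submodule S I -> forall x y, I x -> I y -> I (x + y).
Proof. by case=> _ []. Qed.

Lemma submoduleM S I : submodule S I -> forall s x, S s -> I x -> I (s * x).
Proof. by case=> _ []. Qed.

Lemma submoduleMr S I : submodule S I -> forall s x, S s -> I x -> I (x * s).
Proof. by move=> hI s x Ss Ix; rewrite mulrC; apply: submoduleM hI _ _ Ss Ix. Qed.

Lemma submoduleN S I : subring S -> submodule S I -> forall x, I x -> I (- x).
Proof.
move=> hS hI x Ix; rewrite -mulN1r; apply: (submoduleM hI) => //.
by apply: (subringN hS); apply: subring1.
Qed.

Lemma submodule_sum S I : submodule S I ->
  forall (K : Type) (r : seq K) (P : pred K) F,
  (forall i, P i -> I (F i)) -> I (\sum_(i <- r | P i) F i).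
Proof.
move=> hI K r P F h; apply: (big_ind I) => //.
  exact: submodule0 hI.
exact: submoduleD hI.
Qed.

Lemma subring_submodule S : subring S -> submodule S S.
Proof.
move=> hS; split; first exact: subring0.
by split; [apply: subringD | apply: subringM].
Qed.

Lemma submodule_restrict S E I : subset S E -> submodule E I -> submodule S I.
Proof. by move=> SE [I0 [ID IM]]; split=> //; split=> // s x /SE; apply: IM. Qed.

Lemma End_subring S I : subring S -> submodule S I -> subring (End I).
Proof.
move=> hS hI; split; first by move=> a Ia; rewrite mul1r.
split=> x y hx hy a Ia; last by rewrite -mulrA; apply: hx; apply: hy.
rewrite mulrBl; apply: (submoduleD hI); first exact: hx.
by apply: (submoduleN hS hI); apply: hy.
Qed.

Lemma sub_End S I : submodule S I -> subset S (End I).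
Proof. by move=> hI s Ss a Ia; apply: (submoduleM hI). Qed.

Lemma maximal_ideal_ideal S P : maximal_ideal S P -> ideal S P.
Proof. by case. Qed.

Lemma maximal_proper S P : maximal_ideal S P -> ~ P 1.
Proof. by case=> _ []. Qed.

End Closure.

(** Membership is proved by recursion on the expression; a product in a submodule is tried with
    either factor as the scalar. *)
Ltac mem := solve [ assumption
  | match goal with
    | h : subring ?S |- ?S 1 => exact: (subring1 h)
    | h : subring ?S |- ?S 0 => exact: (subring0 h)
    | h : submodule _ ?S |- ?S 0 => exact: (submodule0 h)
    | h : subring ?S |- ?S (- _) => apply: (subringN h); mem
    | h : subring ?S |- ?S (_ + _) => apply: (subringD h); mem
    | h : subring ?S |- ?S (_ * _) => apply: (subringM h); mem
    | h : submodule _ ?S |- ?S (_ + _) => apply: (submoduleD h); mem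
    | h : submodule ?S ?I, h' : subring ?S |- ?I (- _) => apply: (submoduleN h' h); mem
    | h : submodule _ ?S |- ?S (_ * _) => apply: (submoduleM h); mem
    | h : submodule _ ?S |- ?S (_ * _) => apply: (submoduleMr h); mem
    | h : subset ?A ?B |- ?B _ => apply: h; mem
    end].

(** * Maximal ideals and local rings *)

Section MaximalIdeals.
Variable Q : comUnitRingType.
Implicit Types (S I J E P M : qset Q) (x y : Q).

Lemma exists_maximal S I : ideal S I -> ~ I 1 ->
  exists P, maximal_ideal S P /\ subset I P.
Proof.
move=> idI I1.
pose T := {J : qset Q | ideal S J /\ subset I J /\ ~ J 1}.
pose R (a b : T) := `[< subset (proj1_sig a) (proj1_sig b) >].
have T_eq (a b : T) : set_eq (proj1_sig a) (proj1_sig b) -> a = b.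
  case: a b => [A hA] [B hB] /= /qset_ext eAB; rewrite eAB in hA *.
  by congr exist; apply: Prop_irrelevance.
case: (@classical_sets.Zorn T R).
- by move=> a; apply/asboolP.
- move=> a b c /asboolP ab /asboolP bc; apply/asboolP => x /ab; exact: bc.
- by move=> a b /asboolP ab /asboolP ba; apply: T_eq => x; split; [apply: ab | apply: ba].
(* The union of an empty chain would not contain [I], so [I] itself serves as the bound in that
   case. *)
- move=> A totA; case: (EM (exists a, A a)) => [[a0 Aa0]|noA]; last first.
    have hI : ideal S I /\ subset I I /\ ~ I 1 by split=> //; split=> // x.
    by exists (exist _ I hI) => s As; case: noA; exists s.
  pose U : qset Q := fun x => exists a, A a /\ proj1_sig a x.
  have hU : ideal S U /\ subset I U /\ ~ U 1.
    split; [split; [|split; [|split]] | split].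
    + by move=> x [a [_ ax]]; case: (proj2_sig a) => -[aS _] _; apply: aS.
    + by exists a0; split=> //; case: (proj2_sig a0) => -[_ []].
    + move=> x y [a [Aa ax]] [b [Ab by_]].
      have [/asboolP ab|/asboolP ba] := totA _ _ Aa Ab.
        exists b; split=> //; case: (proj2_sig b) => -[_ [_ [bD _]]] _.
        by apply: bD => //; apply: ab.
      exists a; split=> //; case: (proj2_sig a) => -[_ [_ [aD _]]] _.
      by apply: aD => //; apply: ba.
    + move=> s x Ss [a [Aa ax]]; exists a; split=> //.
      by case: (proj2_sig a) => -[_ [_ [_ aM]]] _; apply: aM.
    + by move=> x Ix; exists a0; split=> //; case: (proj2_sig a0) => _ [h _]; apply: h.
    + by move=> [a [_ a1]]; case: (proj2_sig a) => _ [_]; apply.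
  exists (exist _ U hU) => s As; apply/asboolP => x sx /=; by exists s.
- move=> [P [idP [IP P1]]] maxP; exists P; split=> //; split=> //; split=> // N idN PN.
  case: (EM (N 1)) => N1; [by right | left].
  have hN : ideal S N /\ subset I N /\ ~ N 1 by split=> //; split=> // x /IP/PN.
  have /(_ _)/(congr1 (@proj1_sig _ _)) /= -> := maxP (exist _ N hN) => //.
  exact: asboolT.
Qed.

Lemma nonunit_maximal S x : subring S -> S x -> ~ (exists y, S y /\ x * y = 1) ->
  exists P, maximal_ideal S P /\ P x.
Proof.
move=> hS Sx nux; pose I : qset Q := fun z => exists s, S s /\ z = s * x.
have [|[s [Ss s1]]|P [mP IP]] := @exists_maximal S I.
- split; first by move=> _ [s [Ss ->]]; mem.
  split; first by exists 0; rewrite mul0r; split=> //; mem.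
  split; first by move=> _ _ [s [Ss ->]] [t [St ->]]; exists (s + t); rewrite mulrDl; split=> //; mem.
  by move=> r _ Sr [s [Ss ->]]; exists (r * s); rewrite mulrA; split=> //; mem.
- by case: nux; exists s; rewrite mulrC.
exists P; split=> //; apply: IP; exists 1; rewrite mul1r; split=> //; mem.
Qed.

Lemma maximal_comaximal S P x : subring S -> maximal_ideal S P -> S x -> ~ P x ->
  exists s p, S s /\ P p /\ p + s * x = 1.
Proof.
move=> hS mP Sx nPx.
have [idP [P1 maxP]] := mP; have PS := ideal_sub idP; have mdP := ideal_submodule idP.
pose N : qset Q := fun z => exists s p, S s /\ P p /\ z = p + s * x.
case: (maxP N).
- split; first by move=> _ [s [p [Ss [Pp ->]]]]; mem.
  split; first by exists 0, 0; rewrite mul0r addr0; do ?split=> //; mem.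
  split.
    move=> _ _ [s [p [Ss [Pp ->]]]] [t [q [St [Pq ->]]]].
    by exists (s + t), (p + q); split; [mem | split; [mem | ring]].
  move=> r _ Sr [s [p [Ss [Pp ->]]]]; exists (r * s), (r * p).
  by split; [mem | split; [mem | ring]].
- by move=> p Pp; exists 0, p; rewrite mul0r addr0; do ?split=> //; mem.
- move=> eNP; case: nPx; apply/eNP; exists 1, 0.
  by split; [mem | split; [mem | ring]].
by move=> [s [p [Ss [Pp e]]]]; exists s, p.
Qed.

Lemma distinct_comaximal S P1 P2 : subring S ->
  maximal_ideal S P1 -> maximal_ideal S P2 -> ~ set_eq P1 P2 ->
  exists y, P1 y /\ P2 (1 - y).
Proof.
move=> hS m1 m2 ne12.
have [x [P1x nP2x]] : exists x, P1 x /\ ~ P2 x.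
  apply: contrapT => no; have P12 : subset P1 P2.
    by move=> x P1x; apply: contrapT => nP2x; apply: no; exists x.
  have [_ [_ max1]] := m1; have [id2 [n2 _]] := m2.
  by case: (max1 P2 id2 P12) => // e; apply: ne12 => x; split=> /e.
have [id1 _] := m1.
have [s [p [Ss [Pp e]]]] := maximal_comaximal hS m2 (ideal_sub id1 P1x) nP2x.
exists (s * x); split; first by have md1 := ideal_submodule id1; mem.
by rewrite -e addrK.
Qed.

Definition local_at S M : Prop :=
  maximal_ideal S M /\ forall N, maximal_ideal S N -> set_eq N M.

Lemma local_unit S M x : subring S -> local_at S M -> S x ->
  M x \/ exists y, S y /\ x * y = 1.
Proof.
move=> hS [mM uM] Sx; case: (EM (exists y, S y /\ x * y = 1)) => [|nux]; [by right | left].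
by have [P [mP Px]] := nonunit_maximal hS Sx nux; apply/(uM _ mP).
Qed.

Lemma Jac_local S M : local_at S M -> Jac S = M.
Proof.
move=> [mM uM]; apply: qset_ext => x; split=> [[_ h]|Mx]; first exact: h.
split; first by case: mM => -[MS _] _; apply: MS.
by move=> P mP; apply/(uM _ mP).
Qed.

End MaximalIdeals.

(** * Finitely generated stable modules *)

Section Span.
Variable Q : comUnitRingType.
Implicit Types (S I J E P M : qset Q) (x y : Q).

(** The formula of [fin_gen_ideal], for generators anywhere in [Q]. *)
Definition span S (s : seq Q) : qset Q := fun x =>
  exists c : nat -> Q, (forall i, S (c i)) /\ x = \sum_(i < size s) c i * s`_i.

Lemma span_submodule S s : subring S -> submodule S (span S s).
Proof.
move=> hS; split.
  by exists (fun=> 0); split=> [i|]; [mem | rewrite big1 // => i _; rewrite mul0r].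
split.
  move=> _ _ [c [Sc ->]] [d [Sd ->]]; exists (fun i => c i + d i); split=> [i|].
    by have := Sc i; have := Sd i; move=> *; mem.
  by rewrite -big_split; apply: eq_bigr => i _; rewrite mulrDl.
move=> t _ St [c [Sc ->]]; exists (fun i => t * c i); split=> [i|].
  by have := Sc i; move=> *; mem.
by rewrite mulr_sumr; apply: eq_bigr => i _; rewrite mulrA.
Qed.

Lemma span_nth S s i : subring S -> (i < size s)%N -> span S s s`_i.
Proof.
move=> hS lti; exists (fun j => if j == i then 1 else 0); split=> [j|].
  by case: ifP => _; mem.
rewrite (bigD1 (Ordinal lti)) //= eqxx mul1r big1 ?addr0 // => j /negPf.
by rewrite -val_eqE /= => ->; rewrite mul0r.
Qed.

Lemma span_sub S I s : submodule S I -> (forall i, (i < size s)%N -> I s`_i) ->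
  subset (span S s) I.
Proof.
move=> hI Is _ [c [Sc ->]]; apply: (submodule_sum hI) => i _.
by apply: (submoduleM hI) => //; apply: Is.
Qed.

Lemma span2P S a b z :
  span S [:: a; b] z <-> exists r t, S r /\ S t /\ z = r * a + t * b.
Proof.
split=> [[c [Sc ->]]|[r [t [Sr [St ->]]]]].
  by exists (c 0%N), (c 1%N); rewrite !big_ord_recl big_ord0 addr0.
exists (fun i => if i is 0%N then r else t); split; first by case.
by rewrite !big_ord_recl big_ord0 addr0.
Qed.

Lemma span3P S a b c z :
  span S [:: a; b; c] z <->
  exists r t u, S r /\ S t /\ S u /\ z = r * a + t * b + u * c.
Proof.
split=> [[f [Sf ->]]|[r [t [u [Sr [St [Su ->]]]]]]].
  by exists (f 0%N), (f 1%N), (f 2%N); rewrite !big_ord_recl big_ord0 addr0 addrA.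
exists (fun i => match i with 0%N => r | 1%N => t | _ => u end); split.
  by case=> [|[]].
by rewrite !big_ord_recl big_ord0 addr0 addrA.
Qed.

Lemma common_denominator S s : is_total_quotient_ring S ->
  exists d, S d /\ d \is a GRing.unit /\ forall i, (i < size s)%N -> S (d * s`_i).
Proof.
move=> [hS [nzdU frac]]; elim: s => [|q s [d [Sd [Ud Hd]]]].
  by exists 1; split; [mem | split=> //; apply: unitr1].
have [a [b [Sa [hb ->]]]] := frac q; have Ub := nzdU _ hb; have Sb := proj1 hb.
exists (d * b); split; first by mem.
split; first by rewrite unitrM Ud.
case=> [_|i lti] /=; first by rewrite -mulrA [b * _]mulrC divrK //; mem.
by rewrite mulrAC; have := Hd i lti; move=> *; mem.
Qed.

Lemma unit_nzd S x : S x -> x \is a GRing.unit -> nzd S x.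
Proof. by move=> Sx Ux; split=> // y _ e; apply: (mulrI Ux); rewrite e mulr0. Qed.

(** This says that 1 lies in [(E : I) I]: each pair consists of an element of the colon module and
    one of [I]. *)
Definition invertible_over E I : Prop :=
  exists s : seq (Q * Q),
    (forall p, p \in s -> I p.2 /\ forall a, I a -> E (p.1 * a)) /\
    \sum_(p <- s) p.1 * p.2 = 1.

(* An E-linear map on I extends to the localization Q, so it is the
   multiplication by its value at the unit u divided by u. *)
Lemma projective_invertible S E I u : is_total_quotient_ring S -> subset S E ->
  I u -> u \is a GRing.unit ->
  projective_over E I -> invertible_over E I.
Proof.
move=> [hS [nzdU frac]] SE Iu Uu [J [x [f [Ix [Ef [_ [fM fsum]]]]]]].
have fE j a : I a -> f j a = f j u / u * a.
  move=> Ia; have [c [d [Sc [hd ea]]]] := frac a; have [c' [d' [Sc' [hd' eu]]]] := frac u.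
  have Ud := nzdU _ hd; have Ud' := nzdU _ hd'; have Sd := proj1 hd; have Sd' := proj1 hd'.
  have e1 : d * a = c by rewrite ea mulrC divrK.
  have e2 : d' * u = c' by rewrite eu mulrC divrK.
  (* Both sides are [f j] of the same element, because [d * c' * a = d' * c * u]. *)
  have e : (d * c') * f j a = (d' * c) * f j u.
    rewrite -!fM //; [|by apply: SE; mem..].
    by congr (f j _); rewrite -e1 -e2; ring.
  have U : d * d' * u \is a GRing.unit by rewrite !unitrM Ud Ud'.
  apply: (mulrI U).
  have -> : d * d' * u * f j a = d * c' * f j a by rewrite -e2 !mulrA.
  have -> : d * d' * u * (f j u / u * a) = d' * (d * a) * f j u * (u / u) by ring.
  by rewrite divrr // mulr1 e1 e.
have [s [_ [_ es]]] := fsum u Iu.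
exists [seq (f j u / u, x j) | j <- s]; split.
  move=> _ /mapP[j _ ->] /=; split=> // a Ia; rewrite -fE //; exact: Ef.
rewrite big_map /= -[RHS](divrr Uu) {3}es mulr_suml.
by apply: eq_bigr => j _; rewrite mulrAC.
Qed.

(** Dual basis: the first components of the pairs give the coordinate maps, the second ones the
    generators. *)
Lemma invertible_projective E I : invertible_over E I -> projective_over E I.
Proof.
move=> [s [hs es]]; exists 'I_(size s), (fun j : 'I_(size s) => (nth (0, 0) s j).2).
exists (fun (j : 'I_(size s)) a => (nth (0, 0) s j).1 * a).
split; first by move=> j; case: (hs (nth (0, 0) s j)) => //; apply: mem_nth.
split; first by move=> j a Ia; case: (hs (nth (0, 0) s j)) => [|_]; [apply: mem_nth | apply].
split; first by move=> *; rewrite mulrDr.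
split; first by move=> *; rewrite mulrCA.
move=> a Ia; exists (enum 'I_(size s)); split; first exact: enum_uniq.
split; first by move=> j; rewrite mem_enum.
rewrite big_enum /= -[LHS]mulr1 -es (big_nth (0, 0)) big_mkord mulr_sumr.
by apply: eq_bigr => j _; ring.
Qed.

(** Finite stability speaks of ideals only. A common denominator [d] turns the span into an ideal
    [I] with the same endomorphism ring, and the pairs found for [I] are rescaled by [d] and
    [d^-1]. *)
Lemma span_invertible S s u : is_total_quotient_ring S -> finitely_stable S ->
  span S s u -> u \is a GRing.unit ->
  invertible_over (End (span S s)) (span S s).
Proof.
move=> tS fsS su Uu; have hS := proj1 tS.
have [d [Sd [Ud Hd]]] := common_denominator s tS.
pose I := span S [seq d * x | x <- s].
have II x : I x <-> span S s (d^-1 * x).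
  split=> -[c [Sc e]]; exists c; split=> //.
    rewrite e mulr_sumr size_map; apply: eq_bigr => i _.
    by rewrite (nth_map 0) //= mulrCA (mulKr Ud).
  rewrite -[LHS](mulVKr Ud) e mulr_sumr size_map; apply: eq_bigr => i _.
  by rewrite (nth_map 0) //= mulrCA.
have mdI : submodule S I by apply: span_submodule.
have IS : subset I S.
  apply: span_sub (subring_submodule hS) _ => i; rewrite size_map => lti.
  by rewrite (nth_map 0) //; apply: Hd.
have Idu : I (d * u) by apply/II; rewrite mulKr.
have Udu : d * u \is a GRing.unit by rewrite unitrM Ud.
have [|||_ [_ pI]] := fsS I; first by split.
- exists [seq d * x | x <- s]; split=> // i; rewrite size_map => lti.
  by rewrite (nth_map 0) //; apply: Hd.
- by exists (d * u); split=> //; apply: unit_nzd => //; apply: IS.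
have [l [hl el]] := projective_invertible tS (sub_End mdI) Idu Udu pI.
exists [seq (p.1 * d, d^-1 * p.2) | p <- l]; split; last first.
  rewrite big_map -[RHS]el; apply: eq_bigr => p _ /=.
  by rewrite mulrA mulrK.
move=> _ /mapP[p pl ->] /=; have [Ip2 Ep] := hl _ pl; split; first exact/II.
move=> a sa b sb; have Ida : I (d * a) by apply/II; rewrite mulKr.
have : I (p.1 * (d * a) * (d * b)) by apply: (Ep _ Ida); apply/II; rewrite mulKr.
by move/II; congr span; rewrite -[RHS](mulKr Ud); congr (_ * _); ring.
Qed.

End Span.

(** * The endomorphism ring of the maximal ideal *)

Section Step.
Variable Q : comUnitRingType.
Implicit Types (S I J E P M : qset Q) (x y : Q).

Definition fs_local S M : Prop :=
  [/\ is_total_quotient_ring S, local_at S M, finitely_stable S & regular_ideal S M].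

(* An invertible ideal of a local ring is principal. *)
Lemma span2_principal S M a b u : is_total_quotient_ring S -> local_at S M ->
  finitely_stable S -> span S [:: a; b] u -> u \is a GRing.unit ->
  subset (End (span S [:: a; b])) S ->
  (exists s, S s /\ a = s * b) \/ (exists s, S s /\ b = s * a).
Proof.
move=> tS lS fsS Ju Uu ES; have hS := proj1 tS.
have [l [hl el]] := span_invertible tS fsS Ju Uu.
have [mM _] := lS; have M1 := maximal_proper mM.
have mdM := ideal_submodule (maximal_ideal_ideal mM).
have Sl p : p \in l -> forall z, span S [:: a; b] z -> S (p.1 * z).
  by move=> pl z /(proj2 (hl p pl)) /ES.
(* The terms lie in [S] and sum to 1, so one of them avoids [M] and is a unit. *)
have [p [pl nMp]] : exists p, p \in l /\ ~ M (p.1 * p.2).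
  apply: contrapT => no; apply: M1; rewrite -el big_seq.
  apply: (submodule_sum mdM) => p pl; apply: contrapT => nMp.
  by apply: no; exists p.
have Ip2 := proj1 (hl p pl).
have [//|[v [Sv ev]]] := local_unit hS lS (Sl _ pl _ Ip2).
have Sa : S (p.1 * a).
  apply: (Sl _ pl); apply/span2P; exists 1, 0.
  by split; [mem | split; [mem | ring]].
have Sb : S (p.1 * b).
  apply: (Sl _ pl); apply/span2P; exists 0, 1.
  by split; [mem | split; [mem | ring]].
have [c [d [Sc [Sd ep]]]] : exists c d, S c /\ S d /\ p.2 = c * a + d * b.
  exact/span2P.
(* As [p.1 * p.2] is an [S]-combination of [p.1 * a] and [p.1 * b], one of these two is a unit; its
   generator then generates the other one. *)
have [Ma|[r [Sr er]]] := local_unit hS lS Sa; last first.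
  right; exists (p.1 * b * r); split; first by mem.
  by rewrite -[LHS]mulr1 -er; ring.
have [Mb|[r [Sr er]]] := local_unit hS lS Sb; last first.
  left; exists (p.1 * a * r); split; first by mem.
  by rewrite -[LHS]mulr1 -er; ring.
case: nMp; rewrite ep.
have -> : p.1 * (c * a + d * b) = c * (p.1 * a) + d * (p.1 * b) by ring.
by mem.
Qed.

Variables S M : qset Q.
Hypothesis slM : fs_local S M.
Local Notation T := (End M).

Let tS : is_total_quotient_ring S. Proof. by case: slM. Qed.
Let lS : local_at S M. Proof. by case: slM. Qed.
Let fsS : finitely_stable S. Proof. by case: slM. Qed.
Let hS : subring S. Proof. by case: tS. Qed.
Let mM : maximal_ideal S M. Proof. by case: lS. Qed.
Let M1 : ~ M 1. Proof. exact: maximal_proper mM. Qed.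
Let MS : subset M S. Proof. exact: ideal_sub (maximal_ideal_ideal mM). Qed.
Let mdM : submodule S M. Proof. exact: ideal_submodule (maximal_ideal_ideal mM). Qed.
Let ST : subset S T. Proof. exact: sub_End mdM. Qed.
Let hT : subring T. Proof. exact: End_subring hS mdM. Qed.
Let mdTM : submodule T M.
Proof.
split; first exact: submodule0 mdM.
by split; [apply: submoduleD mdM | move=> t x Tt Mx; apply: Tt].
Qed.
Let Munit : exists m, M m /\ m \is a GRing.unit.
Proof. by case: slM => _ _ _ [m [Mm zm]]; exists m; split=> //; apply: (proj1 (proj2 tS)). Qed.
Let unitS x : S x -> M x \/ exists y, S y /\ x * y = 1.
Proof. exact: local_unit hS lS. Qed.

(** If [End J] lies in [S], principality of [J = S + Sy] forces [y] into [S]. Otherwise some [e] in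
    [End J] outside [S] has the form [r + t * y] with [t] a unit of [S], so that [y] itself
    stabilizes [J]. *)
Lemma End_max_quadratic y : T y -> exists a b, S a /\ S b /\ y * y = a * y + b.
Proof.
move=> Ty; pose J := span S [:: 1; y].
case: (EM (subset (End J) S)) => [ES|nES].
- have Sy : S y.
    have J1 : J 1.
      by apply/span2P; exists 1, 0; split; [mem | split; [mem | ring]].
    have [] := span2_principal tS lS fsS J1 (unitr1 _) ES; last first.
      by move=> [s [Ss ->]]; rewrite mulr1.
    (* Here [1 = s * y]. Since [y] stabilizes [M], [s] in [M] would put 1 in [M]; so [s] is a unit
       and [y] is its inverse. *)
    move=> [s [Ss es]]; have [Ms|[t [St et]]] := unitS Ss.
      by case: M1; rewrite es mulrC; apply: Ty.
    by have <- : t = y by rewrite -[LHS]mulr1 es mulrA [t * s]mulrC et mul1r.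
  by exists y, 0; split; [mem | split; [mem | ring]].
have [e [Je nSe]] : exists e, End J e /\ ~ S e.
  apply: contrapT => no; apply: nES => e Je; apply: contrapT => nSe.
  by apply: no; exists e.
have hJ : submodule S J by exact: span_submodule.
have hE : subring (End J) by exact: End_subring hS hJ.
have SE : subset S (End J) by exact: sub_End.
have J1 : J 1 by apply/span2P; exists 1, 0; split; [mem | split; [mem | ring]].
have Jy : J y by apply/span2P; exists 0, 1; split; [mem | split; [mem | ring]].
have /span2P[r [t [Sr [St]]]] := Je _ J1; rewrite !mulr1 => ee.
(* If [t] were in [M], then [t * y] would be in [M] and [e] in [S]. *)
have [Mt|[t' [St' et]]] := unitS St.
  by case: nSe; rewrite ee; mem.
have Ey : End J y.
  have -> : y = t' * (e - r) by rewrite ee -[LHS]mulr1 -et; ring.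
  by mem.
have /span2P[b [a [Sb [Sa eyy]]]] := Ey _ Jy.
by exists a, b; do ?split=> //; rewrite eyy; ring.
Qed.

Lemma End_max_total : is_total_quotient_ring T.
Proof.
have [_ [nzdU frac]] := tS.
have SnzdT b : nzd S b -> nzd T b.
  by move=> hb; apply: unit_nzd; [apply: ST; case: hb | apply: nzdU].
split=> //; split=> [b [Tb zb]|q]; last first.
  have [a [b [Sa [hb e]]]] := frac q; exists a, b.
  by split; [mem | split=> //; apply: SnzdT].
have [c [d [Sc [hd e]]]] := frac b; have Ud := nzdU _ hd; have Sd := proj1 hd.
have e1 : b * d = c by rewrite e divrK.
rewrite e unitrM unitrV Ud andbT; apply: nzdU; split=> // y Sy cy.
apply: (mulrI Ud); rewrite mulr0; apply: zb; first by mem.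
by rewrite mulrA e1.
Qed.

(** The [S]-span of the generators of [I] is invertible over its own endomorphism ring, which is
    contained in [End I] because [I] is the [T]-span of the same generators. The same pairs then
    witness invertibility of [I]. *)
Lemma End_max_finitely_stable : finitely_stable T.
Proof.
move=> I idI [s [Ts eI]] [v [Iv zv]].
have mdI := ideal_submodule idI.
have Uv : v \is a GRing.unit by apply: (proj1 (proj2 End_max_total)).
have [m [Mm Um]] := Munit.
have eI' : I = span T s by apply: qset_ext => x; apply: eI.
have hI0 := span_submodule s hS.
have I0I : subset (span S s) I.
  rewrite eI' => x [c [Sc ->]]; exists c; split=> // i; exact: ST.
(* Multiplication by [m] carries coefficients from [T] into [M], hence into [S]; this yields a unit
   of [Q] in the [S]-span. *)
have Imv : span S s (m * v).
  have /eI[c [Tc ->]] := Iv; exists (fun i => m * c i); split=> [i|].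
    by apply: MS; rewrite mulrC; apply: Tc.
  by rewrite mulr_sumr; apply: eq_bigr => i _; rewrite mulrA.
have Umv : m * v \is a GRing.unit by rewrite unitrM Um.
have [l [hl el]] := span_invertible tS fsS Imv Umv.
have EE : subset (End (span S s)) (End I).
  move=> e Ee a /eI[c [Tc ->]]; rewrite mulr_sumr.
  apply: (submodule_sum mdI) => i _; rewrite mulrCA; apply: (submoduleM mdI) => //.
  by apply: I0I; apply: Ee; apply: span_nth.
have hEI := End_subring hT mdI; have TEI := sub_End mdI.
split; [|split].
- case: mdI => I0 [ID IM]; split=> //; split=> //; split=> //.
  exists 1; split; first by apply: unit_nzd (unitr1 _); mem.
  by move=> x /(ideal_sub idI); rewrite mul1r.
- by exists v; split=> //; apply: unit_nzd.
apply: invertible_projective; exists l; split=> // p pl; have [Ip2 Ep] := hl p pl.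
split; first exact: I0I.
move=> a /eI[c [Tc ->]]; rewrite mulr_sumr.
apply: (submodule_sum (subring_submodule hEI)) => i _; rewrite mulrCA.
apply: (subringM hEI); first exact: TEI.
by apply: EE; apply: Ep; apply: span_nth.
Qed.

Lemma maximal_End_contract P x : maximal_ideal T P -> S x -> P x -> M x.
Proof.
move=> mP Sx Px; have mdP := ideal_submodule (maximal_ideal_ideal mP).
have [//|[y [Sy exy]]] := unitS Sx.
case: (maximal_proper mP); rewrite -exy.
by have Ty := ST Sy; mem.
Qed.

(** If [m] were outside [P], some [1 - s * m] would be in [P]; as [s * m] is in [M], this element is
    in [S], hence in [M], and so is 1. *)
Lemma sub_maximal_End P : maximal_ideal T P -> subset M P.
Proof.
move=> mP m Mm; apply: contrapT => nPm.
have mdP := ideal_submodule (maximal_ideal_ideal mP).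
have [s [p [Ts [Pp e]]]] := maximal_comaximal hT mP (ST (MS Mm)) nPm.
have Msm : M (s * m) by exact: Ts.
have ep : p = 1 - s * m by rewrite -e addrK.
have Sp : S p by rewrite ep; have := MS Msm; move=> *; mem.
have Mp := maximal_End_contract mP Sp Pp.
by apply: M1; rewrite -e; mem.
Qed.

(** In [y * y = a * y + b], reduction modulo [P1] (where [y] is 0) puts [b] in [M], and reduction
    modulo [P2] (where [y] is 1) puts [a - 1] in [M]. *)
Lemma comaximal_idempotent P1 P2 y : maximal_ideal T P1 -> maximal_ideal T P2 ->
  T y -> P1 y -> P2 (1 - y) -> M (y * y - y).
Proof.
move=> m1 m2 Ty P1y P2y.
have md1 := ideal_submodule (maximal_ideal_ideal m1).
have md2 := ideal_submodule (maximal_ideal_ideal m2).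
have M_2 := sub_maximal_End m2.
have [a [b [Sa [Sb e]]]] := End_max_quadratic Ty; have Ta := ST Sa.
have Mb : M b.
  apply: (maximal_End_contract m1 Sb).
  have -> : b = y * y - a * y by rewrite e; ring.
  by mem.
have Ma : M (a - 1).
  apply: (maximal_End_contract m2); first by mem.
  have -> : a - 1 = (a - 1 - y) * (1 - y) - b.
    by have -> : b = y * y - a * y by [rewrite e; ring]; ring.
  by have P2b := M_2 _ Mb; mem.
have -> : y * y - y = (a - 1) * y + b by rewrite e; ring.
by mem.
Qed.

(* Modulo M, the elements z, y - z and 1 - y would be three orthogonal
   idempotents of T/M; then y and z + (1 - y) span over S a faithful module
   whose endomorphism ring is S, but which is not principal. *)
Lemma no_third_idempotent P1 P2 y z : maximal_ideal T P1 -> maximal_ideal T P2 ->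
  T y -> P1 y -> P2 (1 - y) -> P1 z -> P2 z -> M (z * y - z) -> M z.
Proof.
move=> m1 m2 Ty P1y P2y P1z P2z A2.
have md1 := ideal_submodule (maximal_ideal_ideal m1).
have md2 := ideal_submodule (maximal_ideal_ideal m2).
have Tz : T z := ideal_sub (maximal_ideal_ideal m1) P1z.
have P11 := maximal_proper m1; have P21 := maximal_proper m2.
have M_1 := sub_maximal_End m1; have M_2 := sub_maximal_End m2.
have A1 := comaximal_idempotent m1 m2 Ty P1y P2y.
(* The quadratic equation is applied to [z - y], which is 0 modulo [P1] and -1 modulo [P2]; so [b]
   and [a + 1] are in [M]. *)
have A3 : M (z * z - z).
  have Tw : T (z - y) by mem.
  have [a [b [Sa [Sb e]]]] := End_max_quadratic Tw; have Ta := ST Sa.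
  have eb : b = (z - y) * (z - y) - a * (z - y) by rewrite e; ring.
  have Mb : M b by apply: (maximal_End_contract m1 Sb); rewrite eb; mem.
  have Ma : M (a + 1).
    apply: (maximal_End_contract m2); first by mem.
    have -> : a + 1 = (a + 1 - (z - y)) * (z + (1 - y)) + b by rewrite eb; ring.
    by have P2b := M_2 _ Mb; mem.
  have -> : z * z - z = (a + 1) * (z - y) + b + (z * y - z) + (z * y - z) - (y * y - y).
    by rewrite eb; ring.
  by mem.
apply: contrapT => nMz.
pose B := z + (1 - y); pose J := span S [:: y; B].
have TB : T B by rewrite /B; mem.
have Mm : M (1 - y - (1 - y) * B).
  have -> : 1 - y - (1 - y) * B = (z * y - z) - (y * y - y) by rewrite /B; ring.
  by mem.
have M1y : M (y * (1 - y)).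
  have -> : y * (1 - y) = - (y * y - y) by ring.
  by mem.
have n1y : ~ M (1 - y).
  move=> /M_1 P1y'; apply: P11.
  have -> : (1 : Q) = y + (1 - y) by ring.
  by mem.
have nyz : ~ M (y - z).
  move=> /M_2 P2yz; apply: P21.
  have -> : (1 : Q) = (1 - y) + z + (y - z) by ring.
  by mem.
have MB : M (B * (y - z)).
  have -> : B * (y - z) = (z * y - z) + (z * y - z) - (z * z - z) - (y * y - y).
    by rewrite /B; ring.
  by mem.
have hJ : submodule S J by exact: span_submodule.
have Jy : J y by apply/span2P; exists 1, 0; split; [mem | split; [mem | ring]].
have JB : J B by apply/span2P; exists 0, 1; split; [mem | split; [mem | ring]].
have JT : subset J T.
  by apply: (span_sub (submodule_restrict ST (subring_submodule hT))) => -[|[|]].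
(* Modulo [M] the element [y + (1 - y) * B] is 1, so it is a unit of [S]; thus [y] and [B] generate
   the unit ideal of [T]. *)
have [k [Sk ek]] : exists k, S k /\ k * y + k * ((1 - y) * B) = 1.
  have [||[k [Sk ek]]] := @unitS (1 - (1 - y - (1 - y) * B)).
  - by have := MS Mm; move=> *; mem.
  - move=> Mn; case: M1.
    have -> : (1 : Q) = (1 - (1 - y - (1 - y) * B)) + (1 - y - (1 - y) * B) by ring.
    by mem.
  by exists k; split=> //; rewrite -[RHS]ek; ring.
have Tk := ST Sk.
have [m [MMm Um]] := Munit.
have Jm : J m.
  have -> : m = (m * k) * y + (k * (1 - y) * m) * B by rewrite -[LHS]mulr1 -{1}ek; ring.
  have S1 : S (m * k) by apply: MS; mem.
  have S2 : S (k * (1 - y) * m) by apply: MS; mem.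
  by mem.
have ES : subset (End J) S.
  move=> e Je; have Tey := JT _ (Je _ Jy); have TeB := JT _ (Je _ JB).
  have Te : T e.
    have -> : e = k * (e * y) + (k * (1 - y)) * (e * B) by rewrite -[LHS]mulr1 -{1}ek; ring.
    by mem.
  have /span2P[r [s [Sr [Ss e1]]]] := Je _ Jy.
  have /span2P[r' [s' [Sr' [Ss' e2]]]] := Je _ JB.
  have [Tr [Ts [Tr' Ts']]] : T r /\ T s /\ T r' /\ T s' by do !split; apply: ST.
  (* Compare the two equations for [e] modulo [M] on each idempotent. On [1 - y], [y] is 0 and [B]
     is 1, so [s] vanishes; on [y - z], [y] is 1 and [B] is 0, so [r'] vanishes; on [z] both are 1,
     so [r = s']. Hence [e] is [r] modulo [M]. *)
  have Ms : M s.
    have Ms1 : M (s * (1 - y)).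
      have -> : s * (1 - y) = e * (y * (1 - y)) - r * (y * (1 - y)) + s * (1 - y - (1 - y) * B).
        by rewrite !mulrA e1; ring.
      by mem.
    have [//|[t [St et]]] := unitS Ss; case: n1y; have Tt := ST St.
    have -> : 1 - y = t * (s * (1 - y)) by rewrite mulrA [t * s]mulrC et mul1r.
    by mem.
  have Mr' : M r'.
    have Mr1 : M (r' * (y - z)).
      have -> : r' * (y - z) = e * (B * (y - z)) - s' * (B * (y - z)) - r' * ((y * y - y) - (z * y - z)).
        by rewrite mulrA e2; ring.
      by mem.
    have [//|[t [St et]]] := unitS Sr'; case: nyz; have Tt := ST St.
    have -> : y - z = t * (r' * (y - z)) by rewrite mulrA [t * r']mulrC et mul1r.
    by mem.
  have Mrs : M (r - s').
    have ryB : (r - s') * (y * B) = r' * (y * y) - s * (B * B).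
      have : e * y * B = e * B * y by ring.
      rewrite e1 e2 => h.
      have -> : (r - s') * (y * B) = (r * y + s * B) * B - s * (B * B) - s' * y * B by ring.
      by rewrite h; ring.
    have Mrz : M ((r - s') * z).
      have -> : (r - s') * z = (r - s') * (y * B) - (r - s') * ((z * y - z) - (y * y - y)).
        by rewrite /B; ring.
      by rewrite ryB; mem.
    have Srs : S (r - s') by mem.
    have [//|[t [St et]]] := unitS Srs; case: nMz; have Tt := ST St.
    have -> : z = t * ((r - s') * z) by rewrite mulrA [t * _]mulrC et mul1r.
    by mem.
  have Mer : M (e - r).
    have -> : e - r = s * B + (1 - y) * y * r' - (1 - y) * B * (r - s')
                      + e * (1 - y - (1 - y) * B) - r * (1 - y - (1 - y) * B).
      transitivity (e * y + (1 - y) * (e * B) + e * (1 - y - (1 - y) * B) - r).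
        by ring.
      by rewrite e1 e2; ring.
    by mem.
  have -> : e = r + (e - r) by ring.
  by have Ser := MS Mer; mem.
(* A multiple of [B] vanishes on [y - z], where [y] does not; a multiple of [y] vanishes on [1 - y],
   where [B] does not. *)
case: (span2_principal tS lS fsS Jm Um ES) => -[s [Ss es]]; have Ts := ST Ss.
  apply: nyz.
  have -> : y - z = s * (B * (y - z)) - (y * y - y) + (z * y - z) by rewrite mulrA -es; ring.
  by mem.
apply: n1y.
have -> : 1 - y = s * (y * (1 - y)) + (1 - y - (1 - y) * B) by rewrite es; ring.
by mem.
Qed.

(** Split [x] as [x * y + x * (1 - y)] and apply [no_third_idempotent] to each summand, with [P1]
    and [P2] exchanged for the second. *)
Lemma sub_max_setI P1 P2 x : maximal_ideal T P1 -> maximal_ideal T P2 ->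
  ~ set_eq P1 P2 -> P1 x -> P2 x -> M x.
Proof.
move=> m1 m2 ne12 P1x P2x.
have [y [P1y P2y]] := distinct_comaximal hT m1 m2 ne12.
have md1 := ideal_submodule (maximal_ideal_ideal m1).
have md2 := ideal_submodule (maximal_ideal_ideal m2).
have Ty : T y := ideal_sub (maximal_ideal_ideal m1) P1y.
have Tx : T x := ideal_sub (maximal_ideal_ideal m1) P1x.
have Ty' : T (1 - y) by mem.
have A1 := comaximal_idempotent m1 m2 Ty P1y P2y.
have Mxy : M (x * y).
  apply: (no_third_idempotent m1 m2 Ty P1y P2y); [by mem..|].
  have -> : x * y * y - x * y = x * (y * y - y) by ring.
  by mem.
have Mxy' : M (x * (1 - y)).
  apply: (no_third_idempotent m2 m1 Ty' P2y); [|by mem..|].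
    by have -> : 1 - (1 - y) = y by ring.
  have -> : x * (1 - y) * (1 - y) - x * (1 - y) = x * (y * y - y) by ring.
  by mem.
have -> : x = x * y + x * (1 - y) by ring.
by mem.
Qed.

End Step.

(** * Integrality over a subring *)

Section Integral.
Variables (Q : comUnitRingType) (R : qset Q).
Hypothesis hR : subring R.

(** [integralOver] is stated for a map between ring types, so [R] is made into a subring type whose
    inclusion is [val]. *)
Definition in_subring : {pred Q} := fun x => `[< R x >].

Lemma in_subring_closed : subring_closed in_subring.
Proof.
split; first by apply/asboolP; apply: subring1.
  by move=> x y /asboolP Rx /asboolP Ry; apply/asboolP; apply: subringB.
by move=> x y /asboolP Rx /asboolP Ry; apply/asboolP; apply: subringM.
Qed.

HB.instance Definition _ := GRing.isSubringClosed.Build Q in_subring in_subring_closed.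

Record subring_type := SubringType { subring_val : Q; _ : subring_val \in in_subring }.
HB.instance Definition _ := [isSub for subring_val].
HB.instance Definition _ := [Choice of subring_type by <:].
HB.instance Definition _ := [SubChoice_isSubComNzRing of subring_type by <:].

Definition integral_over (v : Q) : Prop := integralOver (val : subring_type -> Q) v.

Lemma integral_over_sub v : R v -> integral_over v.
Proof.
move=> /asboolP Rv; rewrite -[v]/(val (SubringType Rv)).
exact: (integral_id (val : {rmorphism subring_type -> Q})).
Qed.

(** Transitivity of integrality: [v] is a root of the monic polynomial ['X^2 + q], whose
    coefficients are integral. *)
Lemma integral_over_quadratic a b v : integral_over a -> integral_over b ->
  v * v = a * v + b -> integral_over v.
Proof.
move=> Ia Ib e; pose f : {rmorphism subring_type -> Q} := val.
pose q : {poly Q} := - (a *: 'X + b%:P).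
have sq : (size q <= 2)%N.
  rewrite size_polyN (leq_trans (size_polyD _ _)) // geq_max.
  rewrite (leq_trans (size_scale_leq _ _)) ?size_polyX //.
  by rewrite (leq_trans (size_polyC_leq1 _)).
apply: (@integral_root_monic _ _ f v ('X^2 + q)).
- by rewrite monicE lead_coefDl ?lead_coefXn // size_polyXn.
- by rewrite rootE /q !hornerE -expr2 in e *; rewrite e; apply/eqP; ring.
apply/integral_poly => i; rewrite coefD coefXn coefN coefD coefZ coefX coefC.
have I0 := integral0 f; have I1 := integral1 f.
apply: integral_add; first by case: eqP.
apply: integral_opp; apply: integral_add; last by case: eqP.
by case: eqP => _; rewrite ?mulr1 ?mulr0.
Qed.

(* A monic relation v^n = sum_(i < n) c_i v^i, multiplied by u^(n - 1), expresses
   v = 1/u as a polynomial in u. *)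
Lemma integral_inverse_mem (E : qset Q) u v : subring E -> subset R E -> E u ->
  u * v = 1 -> integral_over v -> E v.
Proof.
move=> hE RE Eu euv [p mon_p /eqP].
pose f : {rmorphism subring_type -> Q} := val; pose c := map_poly f p.
rewrite -[map_poly _ p]/c horner_coef => e.
have Ec i : E c`_i.
  rewrite coef_map; apply: RE; apply/asboolP; exact: (valP p`_i).
have mon_c : c \is monic by apply: (monic_map f).
have : (0 < size c)%N by rewrite lt0n size_poly_eq0 monic_neq0.
case sc : (size c) e => [//|n]; rewrite big_ord_recr /=.
have -> : c`_n = 1 by move/monicP: mon_c; rewrite lead_coefE sc.
rewrite mul1r => e _.
(* A monic relation of degree 0 would read [1 = 0], which is impossible in [Q]. *)
case: n sc e => [|n] sc e.
  by move: e; rewrite big_ord0 add0r expr0 => /eqP; rewrite oner_eq0.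
have -> : v = - (\sum_(i < n.+1) c`_i * u ^+ (n - i)).
  have uvn k : u ^+ k * v ^+ k = 1 by rewrite -exprMn euv expr1n.
  rewrite -[LHS]mul1r -(uvn n) -mulrA -exprSr.
  have -> : v ^+ n.+1 = - (\sum_(i < n.+1) c`_i * v ^+ i).
    by apply/eqP; rewrite -addr_eq0 addrC e.
  rewrite mulrN mulr_sumr; congr (- _); apply: eq_bigr => i _.
  have lein : (i <= n)%N by rewrite -ltnS.
  by rewrite mulrCA -[in u ^+ n](subnK lein) exprD -mulrA uvn mulr1.
apply: (subringN hE); apply: (submodule_sum (subring_submodule hE)) => i _.
by apply: (subringM hE) => //; apply: (subringX hE).
Qed.

End Integral.

(** * The tower of the R_i *)

Section Tower.
Variable Q : comUnitRingType.
Implicit Types (S T I J E P M : qset Q) (x y : Q).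

(** [P1] and [P2] may coincide, so local rings are included. *)
Definition semilocal2 T : Prop := exists P1 P2,
  [/\ maximal_ideal T P1, maximal_ideal T P2 &
      forall N, maximal_ideal T N -> set_eq N P1 \/ set_eq N P2].

(** The invariant of the tower: either the construction still runs through finitely stable local
    rings, or it has become stationary. *)
Definition tame T : Prop :=
  subring T /\ ((exists M, fs_local T M) \/ (semilocal2 T /\ End (Jac T) = T)).

Lemma tame_semilocal2 T : tame T -> semilocal2 T.
Proof.
move=> [_ [[M [_ [mM uM] _ _]]|[]//]]; exists M, M; split=> // N mN; by left; apply: uM.
Qed.

Lemma tame_End_Jac T : tame T ->
  [/\ tame (End (Jac T)), subset T (End (Jac T)) &
      forall y, End (Jac T) y -> exists a b, T a /\ T b /\ y * y = a * y + b].
Proof.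
move=> [hT [[M slM]|[sT eT]]]; last first.
  rewrite eT; split=> //; first by split=> //; right.
  by move=> y Ty; exists y, 0; split; [mem | split; [mem | ring]].
have [tT lT fsT [m [Mm zm]]] := slM; have mM := proj1 lT.
have Um : m \is a GRing.unit by apply: (proj1 (proj2 tT)).
have mdM := ideal_submodule (maximal_ideal_ideal mM).
rewrite (Jac_local lT); set U := End M.
have TU : subset T U by exact: sub_End mdM.
have hU : subring U by exact: End_subring hT mdM.
have MU : subset M U by move=> x /(ideal_sub (maximal_ideal_ideal mM)) /TU.
split=> //; last by move=> y; apply: End_max_quadratic slM _.
split=> //.
case: (EM (exists P1 P2, [/\ maximal_ideal U P1, maximal_ideal U P2 & ~ set_eq P1 P2])).
  move=> [P1 [P2 [m1 m2 ne12]]]; right.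
  have P12 x (P1x : P1 x) (P2x : P2 x) : M x := sub_max_setI slM m1 m2 ne12 P1x P2x.
  split; last first.
    (* [Jac U = M]: the intersection of [P1] and [P2] lies in [M], and [M] lies in every maximal
       ideal of [U]. *)
    congr End; apply: qset_ext => x; split=> [[_ h]|Mx]; first by apply: P12; apply: h.
    by split=> [|P mP]; [apply: MU | apply: (sub_maximal_End slM mP)].
  (* A third maximal ideal [N] would contain [y1 * y2], which is in both [P1] and [P2] and hence in
     [M], although [y1] and [y2] are 1 modulo [N]. *)
  exists P1, P2; split=> // N mN; apply: contrapT => /not_orP[n1 n2].
  have [y1 [P1y Ny1]] := distinct_comaximal hU m1 mN (fun e => n1 (fun x => iff_sym (e x))).
  have [y2 [P2y Ny2]] := distinct_comaximal hU m2 mN (fun e => n2 (fun x => iff_sym (e x))).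
  have md1 := ideal_submodule (maximal_ideal_ideal m1).
  have md2 := ideal_submodule (maximal_ideal_ideal m2).
  have mdN := ideal_submodule (maximal_ideal_ideal mN).
  have Uy1 := ideal_sub (maximal_ideal_ideal m1) P1y.
  have Uy2 := ideal_sub (maximal_ideal_ideal m2) P2y.
  have Ny : N (y1 * y2).
    by apply: (sub_maximal_End slM mN); apply: P12; mem.
  apply: (maximal_proper mN).
  have -> : (1 : Q) = y1 * y2 + (1 - y1) + y1 * (1 - y2) by ring.
  by mem.
move=> noP; left.
have idM : ideal U M.
  split=> //; split; first exact: submodule0 mdM.
  by split; [apply: submoduleD mdM | move=> t x Ut Mx; apply: Ut].
have [P [mP MP]] := exists_maximal idM (maximal_proper mM).
exists P; split; [exact: End_max_total slM| |exact: End_max_finitely_stable slM|].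
  split=> // N mN; apply: contrapT => ne; apply: noP; by exists N, P.
by exists m; split; [apply: MP | apply: unit_nzd => //; apply: MU].
Qed.

Lemma Rseq_tame R M n : fs_local R M -> tame (Rseq R n).
Proof.
move=> slR; elim: n => [|n IH] /=; last by case: (tame_End_Jac IH).
by split; [case: slR => -[] | left; exists M].
Qed.

Lemma Rseq_mono R M m n : fs_local R M -> (m <= n)%N -> subset (Rseq R m) (Rseq R n).
Proof.
move=> slR /subnK <-; elim: (n - m)%N => [|k IH] x Rx //.
by rewrite addSn; have [_ h _] := tame_End_Jac (Rseq_tame (k + m) slR); apply/h/IH.
Qed.

Lemma Rseq_integral R M (hR : subring R) n v : fs_local R M ->
  Rseq R n v -> integral_over hR v.
Proof.
move=> slR; elim: n v => [|n IH] v; first exact: integral_over_sub.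
move=> Rv; have [_ _ /(_ v Rv)[a [b [Ra [Rb e]]]]] := tame_End_Jac (Rseq_tame n slR).
exact: integral_over_quadratic (IH _ Ra) (IH _ Rb) e.
Qed.

(* With J = R + Rx + Ry and E = End J, the ideal (E : J) of E contains a unit
   of some R_n; by integrality this is a unit of E, so that J is a ring. *)
Lemma Rinf_quadratic R M : fs_local R M -> quadratic_ext R (Rinf R).
Proof.
move=> slR x y [i [_ Rx]] [j [_ Ry]]; set n := (i + j)%N.
have [tR _ fsR _] := slR; have hR := proj1 tR.
have tT := Rseq_tame n slR; have hT := proj1 tT.
set T := Rseq R n in tT hT.
have RT : subset R T by apply: (Rseq_mono slR (leq0n n)).
have Tx : T x := Rseq_mono slR (leq_addr j i) Rx.
have Ty : T y := Rseq_mono slR (leq_addl i j) Ry.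
pose J := span R [:: 1; x; y].
have hJ : submodule R J by exact: span_submodule.
have hE : subring (End J) by exact: End_subring hR hJ.
have RE : subset R (End J) by exact: sub_End.
have J1 : J 1 := @span_nth _ R [:: 1; x; y] 0 hR isT.
have Jx : J x := @span_nth _ R [:: 1; x; y] 1 hR isT.
have Jy : J y := @span_nth _ R [:: 1; x; y] 2 hR isT.
have JT : subset J T.
  apply: (span_sub (submodule_restrict RT (subring_submodule hT))).
  by case=> [|[|[|]]] //= _; mem.
have EJ e : End J e -> J e by move=> /(_ 1 J1); rewrite mulr1.
have [l [hl el]] := span_invertible tR fsR J1 (unitr1 _).
(* The colon ideal [(E : J)]; since 1 is in [J], it lies in [E], hence in [J] and in [T]. *)
pose A q := forall a, J a -> End J (q * a).
have AE q : A q -> End J q by move=> /(_ 1 J1); rewrite mulr1.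
have AT q : A q -> T q by move=> /AE/EJ/JT.
have AD q q' : A q -> A q' -> A (q + q').
  by move=> Aq Aq' a Ja; rewrite mulrDl; have := Aq a Ja; have := Aq' a Ja; move=> *; mem.
(* Since 1 is a sum of products of elements of [A] and [J], no proper ideal of [T] contains [A]. *)
have A_P P : maximal_ideal T P -> exists q, A q /\ ~ P q.
  move=> mP; apply: contrapT => no; apply: (maximal_proper mP).
  have mdP := ideal_submodule (maximal_ideal_ideal mP).
  rewrite -el big_seq; apply: (submodule_sum mdP) => p pl; have [Jp Ap] := hl p pl.
  apply: (submoduleMr mdP); first exact: JT.
  by apply: contrapT => nP; apply: no; exists p.1.
have [P1 [P2 [m1 m2 P12]]] := tame_semilocal2 tT.
have md1 := ideal_submodule (maximal_ideal_ideal m1).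
have md2 := ideal_submodule (maximal_ideal_ideal m2).
(* Avoidance of two ideals: one of [a], [b], [a + b] works. *)
have [u [Au [n1 n2]]] : exists u, A u /\ ~ P1 u /\ ~ P2 u.
  have [a [Aa na]] := A_P _ m1; have [b [Ab nb]] := A_P _ m2.
  case: (EM (P2 a)) => [P2a|]; last by exists a.
  case: (EM (P1 b)) => [P1b|]; last by exists b.
  exists (a + b); split; first exact: AD.
  split=> h; [apply: na|apply: nb].
    by have -> : a = (a + b) - b by [ring]; mem.
  by have -> : b = (a + b) - a by [ring]; mem.
have [v [Tv uv]] : exists v, T v /\ u * v = 1.
  apply: contrapT => /(nonunit_maximal hT (AT _ Au))[P [mP Pu]].
  by case: (P12 _ mP) => /(_ u)[/(_ Pu)].
have Ev : End J v.
  exact: integral_inverse_mem hE RE (AE _ Au) uv (Rseq_integral hR slR Tv).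
(* Write [x] as [(u * x) * v], where [u * x] is in [End J] because [u] is in [A] and [x] in [J]. *)
have Ex : End J x.
  by rewrite -[x]mul1r -uv mulrAC mulrC; apply: (subringM hE) => //; apply: Au.
have /span3P[c [a [b [Rc [Ra [Rb e]]]]]] := Ex _ Jy.
by exists a, b, c; do 3!split=> //; rewrite e; ring.
Qed.

(** The three elements witnessing pairwise comaximality lie in one common [T n]. The contractions to
    [T n] are contained in maximal ideals, which these witnesses keep distinct, while [T n] has at
    most two. *)
Lemma Rinf_two_maximal R M : fs_local R M -> at_most_two_maximal_ideals (Rinf R).
Proof.
move=> slR P1 P2 P3 m1 m2 m3.
pose T n := Rseq R n.
have hT n : subring (T n) by case: (Rseq_tame n slR).
have TR n : subset (T n) (Rinf R).
  (* The union [Rinf] starts at index 1, so the index is shifted to include [T 0]. *)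
  by move=> x Tx; exists n.+1; split=> //; apply: (Rseq_mono slR (leqnSn n)).
have hR : subring (Rinf R).
  split; first by apply: (TR 0%N); apply: subring1.
  by split=> x y [i [_ Rx]] [j [_ Ry]]; apply: (TR (i + j)%N);
    [apply: subringB | apply: subringM]; first [exact: hT
      | exact: (Rseq_mono slR (leq_addr j i) Rx)
      | exact: (Rseq_mono slR (leq_addl i j) Ry)].
have comax P P' : maximal_ideal (Rinf R) P -> maximal_ideal (Rinf R) P' ->
    ~ set_eq P P' -> exists n y, T n y /\ P y /\ P' (1 - y).
  move=> mP mP' ne; have [y [Py P'y]] := distinct_comaximal hR mP mP' ne.
  by have [n [_ Ty]] := ideal_sub (maximal_ideal_ideal mP) Py; exists n, y.
apply: contrapT => /not_orP[n12 /not_orP[n13 n23]].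
have [i [x [Tx [P1x P2x]]]] := comax _ _ m1 m2 n12.
have [j [y [Ty [P1y P3y]]]] := comax _ _ m1 m3 n13.
have [k [z [Tz [P2z P3z]]]] := comax _ _ m2 m3 n23.
pose n := (i + j + k)%N.
have {}Tx : T n x by apply: (Rseq_mono slR _ Tx); rewrite /n -addnA leq_addr.
have {}Ty : T n y by apply: (Rseq_mono slR _ Ty); rewrite /n addnAC leq_addl.
have {}Tz : T n z by apply: (Rseq_mono slR _ Tz); rewrite /n leq_addl.
have hTn := hT n.
have above P : maximal_ideal (Rinf R) P ->
    exists N, maximal_ideal (T n) N /\ forall t, T n t -> P t -> N t.
  move=> mP; have mdP := ideal_submodule (maximal_ideal_ideal mP).
  have [|[]|N [mN PN]] := @exists_maximal _ (T n) (fun t => T n t /\ P t).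
  - split; first by move=> t [].
    split; first by split; mem.
    split; first by move=> s t [Ts Ps] [Tt Pt]; split; mem.
    move=> s t Ts [Tt Pt]; split; first by mem.
    by have Rs := TR n _ Ts; mem.
  - by move=> _; apply: (maximal_proper mP).
  by exists N; split=> // t Tt Pt; apply: PN.
have apart P P' N N' t : maximal_ideal (T n) N -> T n t ->
    (forall s, T n s -> P s -> N s) -> (forall s, T n s -> P' s -> N' s) ->
    P t -> P' (1 - t) -> ~ set_eq N' N.
  move=> mN Tt PN PN' Pt Pt' e; apply: (maximal_proper mN).
  have mdN := ideal_submodule (maximal_ideal_ideal mN).
  have Nt := PN _ Tt Pt.
  have Nt' : N (1 - t) by apply/e; apply: PN' => //; mem.
  have -> : (1 : Q) = t + (1 - t) by ring.
  by mem.
have [N1 [mN1 PN1]] := above _ m1.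
have [N2 [mN2 PN2]] := above _ m2.
have [N3 [mN3 PN3]] := above _ m3.
have a12 := apart _ _ _ _ x mN1 Tx PN1 PN2 P1x P2x.
have a13 := apart _ _ _ _ y mN1 Ty PN1 PN3 P1y P3y.
have a23 := apart _ _ _ _ z mN2 Tz PN2 PN3 P2z P3z.
have [K1 [K2 [_ _ K]]] := tame_semilocal2 (Rseq_tame n slR).
have [/qset_ext e1|/qset_ext e1] := K _ mN1;
have [/qset_ext e2|/qset_ext e2] := K _ mN2;
have [/qset_ext e3|/qset_ext e3] := K _ mN3;
by [apply: a12; rewrite e1 e2|apply: a13; rewrite e1 e3|apply: a23; rewrite e2 e3].
Qed.

End Tower.

Theorem theorem3p9 (Q : comUnitRingType) (R M : qset Q) :
  is_total_quotient_ring R ->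
  local R -> maximal_ideal R M ->
  finitely_stable R ->
  regular_ideal R M -> stable R M ->
  quadratic_ring R /\ at_most_two_maximal_ideals (Rinf R).
Proof.
move=> tR lR mM fsR rM sM.
have slR : fs_local R M.
  split=> //; split=> // N mN; have [M' [_ uM']] := lR.
  by rewrite (qset_ext (uM' _ mN)) (qset_ext (uM' _ mM)).
split; last exact: Rinf_two_maximal slR.
split=> //; split; last exact: Rinf_quadratic slR.
by exists M.
Qed.
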